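(* Let $\beta\in(0,1]$ and let $\mathcal{A}$ be any $\beta$-computationally balanced standard integer multiplication algorithm multiplying two integers $A,B$, each represented with $n$ base-$s$ digits, using $P$ processors each equipped with an unbounded local memory. Assume that at the beginning of the execution each digit of the input integers is stored in the local memory of a single processor, and that each message moves up to $B_m$ memory words. Then in every execution some processor sends or receives $$\Omega\!\left(\sqrt{\beta}\,\frac{n}{\sqrt{P}\,B_m}-\frac{2n}{PB_m}\right)$$ messages.
   Context: Integers are written in base $s\ge2$, one digit per memory word; $A=(A[n-1],\dots,A[0])_s$. An algorithm multiplying $n$-digit integers $A,B$ is standard if (i) it directly computes all $n^2$ elementary products $A[i]B[j]$, $0\le i,j\le n-1$; (ii) each digit $C[i]$ of $C=AB$ is computed by summing the elementary products $A[j]B[k]$ with $j+k=i$ through a summation tree using additions and subtractions only, plus any carry; (iii) the internal vertex sets of the summation trees of distinct $C[i]$ are disjoint (computations viewed as computational DAGs). A parallel standard algorithm is $\beta$-computationally balanced if each of the $P$ processors computes at least $\beta n^2/P$ of the $n^2$ elementary products. Parallel model: $P$ processors with local (non-shared) memories exchanging point-to-point messages; a processor operates only on values in its local memory; recomputation allowed. *)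

(* Defs.v *)
From mathcomp Require Import all_boot all_order all_algebra.

Set Implicit Arguments.
Unset Strict Implicit.
Unset Printing Implicit Defensive.

Import Order.TTheory GRing.Theory Num.Theory.
Local Open Scope ring_scope.

(* Vertices stand for values, each of them occupying one memory word.  The
   [input] vertices are given; any other vertex [v] is obtained by applying
   [op v] to the values of its predecessors [args v] (constants are the
   non-input vertices without predecessors). *)
Record cdag := Cdag {
  vertex :> finType;
  input : {set vertex};
  args : vertex -> seq vertex;
  op : vertex -> seq int -> int;
  edge : rel vertex := fun u v => u \in args v;
  input_args : forall v, v \in input -> args v = [::];
  acyclic : forall u v, edge u v -> ~~ connect edge v u }.

(* The inputs are the 2n digits, each of them a vertex of its own; a product of
   two n-digit integers has 2n digits.  [prod i j] is the vertex of
   the elementary product A[i]B[j]. *)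
Record mul_cdag (n : nat) := MulCdag {
  graph :> cdag;
  digA : 'I_n -> graph;
  digB : 'I_n -> graph;
  digC : 'I_(2 * n) -> graph;
  prod : 'I_n -> 'I_n -> graph;
  digA_inj : injective digA;
  digB_inj : injective digB;
  digAB_neq : forall i j, digA i != digB j;
  inputE : input graph = [set digA i | i : 'I_n] :|: [set digB j | j : 'I_n] }.

Section Standard.

Variables (s n : nat) (G : mul_cdag n).

(* [val] assigns to each vertex the value it takes when the digits are [a] and
   [b]; since the graph is acyclic there is exactly one such [val]. *)
Definition evaluates (a b : 'I_n -> 'I_s) (val : G -> int) : Prop :=
  [/\ forall i, val (digA G i) = (a i)%:Z,
      forall j, val (digB G j) = (b j)%:Z &
      forall v, v \notin input G -> val v = op v (map val (args v))].

Definition number (a : 'I_n -> 'I_s) : int := \sum_(i < n) (a i)%:Z * s%:Z ^+ i.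

Definition multiplies : Prop :=
  forall a b val, evaluates a b val ->
    (forall k, 0 <= val (digC G k) < s%:Z) /\
    \sum_(k < 2 * n) val (digC G k) * s%:Z ^+ k = number a * number b.

Definition computes_elementary_products : Prop :=
  forall i j, [/\ prod G i j \notin input G,
                  args (prod G i j) = [:: digA G i; digB G j] &
                  forall x y : int, op (prod G i j) [:: x; y] = x * y].

(* [Node v true l r] is the difference l - r and [Node v false l r] the sum
   l + r, computed at vertex v. *)
Inductive sum_tree : Type :=
  | Leaf of G
  | Node of G & bool & sum_tree & sum_tree.

Definition root (t : sum_tree) : G :=
  match t with Leaf v => v | Node v _ _ _ => v end.

Fixpoint internal (t : sum_tree) : seq G :=
  match t with
  | Leaf _ => [::]
  | Node v _ l r => v :: internal l ++ internal r
  end.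

Fixpoint leaves (t : sum_tree) : seq G :=
  match t with
  | Leaf v => [:: v]
  | Node _ _ l r => leaves l ++ leaves r
  end.

(* Signed number of occurrences of u among the leaves. *)
Fixpoint coef (u : G) (t : sum_tree) : int :=
  match t with
  | Leaf v => (v == u)%:Z
  | Node _ sub l r => if sub then coef u l - coef u r else coef u l + coef u r
  end.

Fixpoint in_graph (t : sum_tree) : Prop :=
  match t with
  | Leaf _ => True
  | Node v sub l r =>
      [/\ v \notin input G, args v = [:: root l; root r],
          forall x y : int, op v [:: x; y] = (if sub then x - y else x + y),
          in_graph l & in_graph r]
  end.

(* A carry into position i comes from lower positions: it depends only on
   elementary products A[j]B[k] with j + k < i.  How it is computed is left
   free. *)
Definition carry_into (i : nat) (v : G) : Prop :=
  [/\ v \notin input G, forall j k, v != prod G j k &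
      forall j k, connect (@edge G) (prod G j k) v -> (j + k < i)%N].

(* The root of the tree holds the sum of the A[j]B[k] with j + k = i plus the
   carries; the digit C[i] is its residue modulo s.  How the residue is
   extracted from the root is left free. *)
Definition summation_tree (i : 'I_(2 * n)) (t : sum_tree) : Prop :=
  [/\ in_graph t /\ uniq (internal t),
      forall j k : 'I_n, (j + k)%N = i -> coef (prod G j k) t = 1,
      forall v, v \in leaves t ->
        (exists j k : 'I_n, (j + k)%N = i /\ v = prod G j k)
        \/ carry_into i v &
      connect (@edge G) (root t) (digC G i) /\
      forall a b val, evaluates a b val ->
        val (digC G i) = (val (root t) %% s)%Z].

Definition standard : Prop :=
  [/\ multiplies, computes_elementary_products &
      exists T : 'I_(2 * n) -> sum_tree,
        (forall i, summation_tree i (T i)) /\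
        (forall i i', i != i' ->
           forall v, v \in internal (T i) -> v \notin internal (T i'))].

End Standard.

Section Execution.

Variables (n P : nat) (G : mul_cdag n).

(* [Message p q X] moves the words of X from the memory of p to that of q. *)
Inductive event : Type :=
  | Compute of 'I_P & G
  | Message of 'I_P & 'I_P & {set G}.

Definition memory := 'I_P -> {set G}.

(* The local memories being unbounded, no value is ever discarded. *)
Definition step (m : memory) (e : event) : memory :=
  match e with
  | Compute p v => fun q => if q == p then v |: m q else m q
  | Message _ r X => fun q => if q == r then X :|: m q else m q
  end.

Definition enabled (Bm : nat) (m : memory) (e : event) : bool :=
  match e with
  | Compute p v => (v \notin input G) && all (mem (m p)) (args v)
  | Message p q X => [&& p != q, X \subset m p & (#|X| <= Bm)%N]
  end.

Fixpoint enabled_trace (Bm : nat) (m : memory) (tr : seq event) : bool :=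
  if tr is e :: tr' then enabled Bm m e && enabled_trace Bm (step m e) tr'
  else true.

(* The trace lists the events of all processors in an order compatible with
   causality; the same vertex may be computed many times, by one or by several
   processors. *)
Record execution := Execution { initial : memory; trace : seq event }.

Definition final (x : execution) : memory := foldl step (initial x) (trace x).

Definition valid (Bm : nat) (x : execution) : Prop :=
  [/\ forall p, initial x p \subset input G,
      enabled_trace Bm (initial x) (trace x) &
      forall k, exists p, digC G k \in final x p].

Definition single_copy_inputs (x : execution) : Prop :=
  forall v, v \in input G -> #|[set p | v \in initial x p]| = 1%N.

Definition is_compute (p : 'I_P) (v : G) (e : event) : bool :=
  if e is Compute q u then (q == p) && (u == v) else false.

Definition computed_products (x : execution) (p : 'I_P) : {set 'I_n * 'I_n} :=
  [set ij | has (is_compute p (prod G ij.1 ij.2)) (trace x)].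

Definition is_message_of (p : 'I_P) (e : event) : bool :=
  if e is Message q r _ then (q == p) || (r == p) else false.

(* Number of messages sent or received by p. *)
Definition messages (x : execution) (p : 'I_P) : nat :=
  count (is_message_of p) (trace x).

End Execution.

(* A parallel algorithm may have many executions (depending on the operands,
   the placement of the inputs, the relative speeds of the processors). *)
Record parallel_algorithm (n P : nat) := ParallelAlgorithm {
  alg_cdag :> mul_cdag n;
  runs : execution P alg_cdag -> Prop }.

Definition balanced (R : rcfType) (beta : R) (n P : nat)
    (Alg : parallel_algorithm n P) : Prop :=
  forall x, @runs n P Alg x -> forall p : 'I_P,
    beta * n%:R ^+ 2 / P%:R <= #|computed_products x p|%:R.

(* Main.v *)
(* A processor that computes the elementary products indexed by a set S must
   have held a digits of A and b digits of B with |S| <= a b.  Inputs are never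
   computed, so a + b is at most the number of inputs it held initially plus
   B_m words per message received.  Since every input is initially stored once,
   some processor starts with at most 2n/P inputs; by balance it has
   beta n^2 / P <= a b <= (a + b)^2, and comparing the two bounds on a + b
   gives the claim with constant 1. *)
Require Import Defs.
From mathcomp Require Import all_boot all_order all_algebra.

Set Implicit Arguments.
Unset Strict Implicit.
Unset Printing Implicit Defensive.

Import Order.TTheory GRing.Theory Num.Theory.
Local Open Scope ring_scope.

(** A minimiser of [f] works. Multiplying by [P] avoids a truncated division in [nat]. *)
Lemma ex_le_average (P : nat) (f : 'I_P -> nat) :
  (0 < P)%N -> exists p, (P * f p <= \sum_q f q)%N.
Proof.
case: P f => // P f _.
have [p _ minp] := @arg_minnP _ ord0 xpredT f isT.
exists p; rewrite -[P.+1 in leqLHS]card_ord -sum_nat_const.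
by apply: leq_sum => q _; apply: minp.
Qed.

Section Trace.

Variables (n P : nat) (G : mul_cdag n).
Implicit Types (m : memory P G) (tr : seq (event P G)) (p : 'I_P).

Lemma step_subset m (e : event P G) p : m p \subset step m e p.
Proof.
case: e => [q v|q r X] /=; case: ifP => // _; first exact: subsetUr.
exact: subsetUr.
Qed.

Lemma foldl_step_subset m tr p : m p \subset foldl (@step n P G) m tr p.
Proof.
elim: tr m => [|e tr IH] m //=.
exact: subset_trans (step_subset m e p) (IH _).
Qed.

(** The operands are in the memory of [p] when [v] is computed there, and memories only grow along a
    trace. *)
Lemma computed_args_in_memory Bm m tr p v :
  enabled_trace Bm m tr -> has (is_compute p v) tr ->
  {subset args v <= foldl (@step n P G) m tr p}.
Proof.
elim: tr m => //= e tr IH m /andP[en_e en_tr] /orP[|has_tr]; last exact: IH.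
case: e en_e {en_tr} => //= q u /andP[_ /allP args_q] /andP[/eqP qp /eqP uv].
rewrite {}qp {}uv in args_q * => w /args_q w_m.
apply: (subsetP (foldl_step_subset _ _ _)).
by apply: (subsetP (step_subset _ (Compute p v) _)).
Qed.

(** Induction on the trace: the only event that can bring new inputs to [p] is a message that it
    receives, which carries at most [Bm] words. *)
Lemma card_inputs_le_messages Bm m tr p :
  enabled_trace Bm m tr ->
  (#|foldl (@step n P G) m tr p :&: input G|
     <= #|m p :&: input G| + Bm * count (is_message_of p) tr)%N.
Proof.
elim: tr m => [|e tr IH] m /=; first by rewrite muln0 addn0.
move=> /andP[en_e /IH/leq_trans]; apply.
rewrite mulnDr addnA leq_add2r.
case: e en_e => [q v|q r X] /= => [/andP[v_comp _]|/and3P[_ _ leX]].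
  (* The vertex added by a computation is not an input, so the intersection does not grow. *)
  rewrite muln0 addn0; case: ifP => // _; apply/subset_leq_card/subsetP => w.
  by rewrite !inE; case: eqP => //= ->; rewrite (negPf v_comp) andbF.
(* Unless [p] is the receiver its memory is unchanged, whether or not the message counts as sent by
   [p]. *)
have [->|_] := eqVneq p r; last exact: leq_addr.
rewrite orbT muln1 setIUl addnC (leq_trans (leq_card_setU _ _)) // leq_add2r.
exact: leq_trans (subset_leq_card (subsetIl _ _)) leX.
Qed.

Lemma card_input_le : (#|input G| <= 2 * n)%N.
Proof.
rewrite inputE (leq_trans (leq_card_setU _ _)) // mul2n -addnn.
by apply: leq_add; rewrite (leq_trans (leq_imset_card _ _)) // card_ord.
Qed.

(** Double counting of the pairs of a processor and an input that it holds initially. *)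
Lemma sum_initial_inputs (x : execution P G) :
  single_copy_inputs x ->
  (\sum_p #|initial x p :&: input G| = #|input G|)%N.
Proof.
move=> copy1.
transitivity (\sum_p \sum_(v in input G | v \in initial x p) 1)%N.
  by apply: eq_bigr => p _; rewrite -sum1_card; apply: eq_bigl => v;
     rewrite inE andbC.
rewrite (exchange_big_dep (mem (input G))) /=; last by move=> p v _ /andP[].
rewrite -sum1_card; apply: eq_bigr => v v_in.
rewrite -[RHS](copy1 v v_in) -sum1_card.
by apply: eq_bigl => p; rewrite !inE v_in.
Qed.

Lemma card_products_le Bm (x : execution P G) p :
  computes_elementary_products G -> enabled_trace Bm (initial x) (trace x) ->
  (#|computed_products x p| <= #|final x p :&: input G| ^ 2)%N.
Proof.
move=> prodG en_x; set A := [set i | digA G i \in final x p].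
set B := [set j | digB G j \in final x p].
have subAB : computed_products x p \subset setX A B.
  apply/subsetP => -[i j]; rewrite !inE /= => comp_ij.
  have sub := computed_args_in_memory en_x comp_ij.
  have [_ argsE _] := prodG i j; rewrite argsE in sub.
  by rewrite !sub ?inE ?eqxx ?orbT.
rewrite (leq_trans (subset_leq_card subAB)) // cardsX -mulnn.
have memA i : digA G i \in input G by rewrite inputE inE imset_f.
have memB j : digB G j \in input G by rewrite inputE inE orbC imset_f.
(* Each side of the rectangle [setX A B] injects, through [digA] or [digB], into the inputs held by
   [p] at the end. *)
apply: leq_mul.
  rewrite -(card_imset _ (@digA_inj _ G)) subset_leq_card //.
  by apply/subsetP => _ /imsetP[i + ->]; rewrite !inE memA andbT.
rewrite -(card_imset _ (@digB_inj _ G)) subset_leq_card //.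
by apply/subsetP => _ /imsetP[j + ->]; rewrite !inE memB andbT.
Qed.

End Trace.

Theorem theorem5 (R : rcfType) :
  exists c : R, 0 < c /\
    forall (s n P Bm : nat) (beta : R) (Alg : parallel_algorithm n P),
      (2 <= s)%N -> (0 < n)%N -> (0 < P)%N -> (0 < Bm)%N ->
      0 < beta <= 1 ->
      standard s Alg ->
      balanced beta Alg ->
      (forall x, @runs n P Alg x -> valid Bm x /\ single_copy_inputs x) ->
      forall x, @runs n P Alg x ->
      exists p : 'I_P,
        c * (Num.sqrt beta * (n%:R / (Num.sqrt P%:R * Bm%:R))
             - (2 * n)%:R / (P%:R * Bm%:R))
        <= (messages x p)%:R.
Proof.
exists 1; split=> // s n P Bm beta Alg _ _ P_gt0 Bm_gt0 /andP[beta_gt0 _].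
move=> [_ prodG _] bal runsP x run_x.
have [[_ en_x _] copy1] := runsP x run_x.
(* Only the initial placement decides the choice of [p]: balance holds for every processor. *)
have [p] := ex_le_average (fun p => #|initial x p :&: input Alg|) P_gt0.
rewrite sum_initial_inputs // => /leq_trans/(_ (card_input_le Alg)) init_p.
exists p; rewrite mul1r.
have P0 : 0 < P%:R :> R by rewrite ltr0n.
have B0 : 0 < Bm%:R :> R by rewrite ltr0n.
set k := #|final x p :&: input Alg|.
have sqrt_le : Num.sqrt beta * n%:R / Num.sqrt P%:R <= k%:R :> R.
  have -> : Num.sqrt beta * n%:R / Num.sqrt P%:R
            = Num.sqrt (beta * n%:R ^+ 2 / P%:R).
    rewrite sqrtrM ?mulr_ge0 ?exprn_ge0 ?ler0n ?(ltW beta_gt0) //.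
    by rewrite sqrtrM ?(ltW beta_gt0) // sqrtr_sqr normr_nat sqrtrV ?ler0n.
  rewrite -[k%:R]normr_nat -sqrtr_sqr ler_wsqrtr //.
  apply: le_trans (bal x run_x p) _.
  by rewrite -natrX ler_nat; apply: card_products_le prodG en_x.
have k_le : k%:R <= (messages x p)%:R * Bm%:R + (2 * n)%:R / P%:R :> R.
  have: k%:R <= (#|initial x p :&: input Alg| + Bm * messages x p)%:R :> R.
    by rewrite ler_nat; apply: card_inputs_le_messages en_x.
  move/le_trans; apply.
  rewrite natrD natrM mulrC addrC lerD2l ler_pdivlMr // mulrC -natrM.
  by rewrite ler_nat.
(* Clearing the common factor [Bm] leaves exactly the comparison of the two bounds on [k]. *)
rewrite !invfM !mulrA -mulrBl ler_pdivrMr // lerBlDr.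
exact: le_trans sqrt_le k_le.
Qed.
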